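(* Let $N$ be a large integer, let $\{a_n\}$ be a complex sequence, and let $$f(x,t)=\sum_{n=1}^N a_n e(nx+n^2t)$$ be defined on the torus $\mathbb T^2$. For $j\in[1,N]\cap\mathbb Z$ let $S_j=[0,1]\times\big[\frac{j-1}{N},\frac jN\big]\subset[0,1]^2$ (a horizontal strip). Let $\lambda\in[N^{1/4},N^{1/2}]$ be a dyadic number. Define $\#_\lambda$ to be the number of horizontal strips $S_j$ such that there is a point $(x_j,t_j)$ in $S_j$ with $|f(x_j,t_j)|\sim\lambda\|a_n\|_{l^2}$. Then $$\#_\lambda\lessapprox N^2\lambda^{-4},$$ that is, for every $\epsilon>0$ there is a constant $C_\epsilon>0$, depending only on $\epsilon$ (and on the implicit constants in $\sim$), such that $\#_\lambda\le C_\epsilon N^\epsilon N^2\lambda^{-4}$.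
   Context: Notation: $e(z)=e^{2\pi i z}$ for $z\in\mathbb R$; $\mathbb T^2=\mathbb R^2/\mathbb Z^2$ is identified with $[0,1]^2$. A dyadic number is an integer power of $2$. $A\lesssim B$ means $A\le CB$ for some positive constant $C$, and $A\sim B$ means that both $A\lesssim B$ and $B\lesssim A$. $\|a_n\|_{l^2}=\big(\sum_{n=1}^N|a_n|^2\big)^{1/2}$.
   Formalization: The sequence is assumed to have some nonzero a_n with 1 ≤ n ≤ N; for the zero sequence every strip satisfies 0 ~ 0, so the count is N and the bound fails for λ = N^{1/2}, ε < 1. *)

(* Defs.v *)
From mathcomp Require Import all_boot all_order all_algebra.
From mathcomp Require Import all_classical all_reals all_analysis.
From mathcomp Require Export complex.

Set Implicit Arguments.
Unset Strict Implicit.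
Unset Printing Implicit Defensive.

Import Order.TTheory GRing.Theory Num.Theory.

Local Open Scope classical_set_scope.
Local Open Scope complex_scope.
Local Open Scope ring_scope.

Section Defs.
Variable R : realType.

(* The order and norm of [R[i]] take values in [R[i]]; the real-valued modulus
   is the real part of the norm. *)
Definition cabs (z : R[i]) : R := complex.Re `|z|.

(* e(z) = exp(2 pi i z). *)
Definition e1 (z : R) : R[i] := cos (2 * pi * z) +i* sin (2 * pi * z).

(* Only the entries [a 1, ..., a N] of the sequence matter. *)
Definition expsum (N : nat) (a : nat -> R[i]) (x t : R) : R[i] :=
  \sum_(1 <= n < N.+1) a n * e1 (n%:R * x + n%:R ^+ 2 * t).

Definition l2norm (N : nat) (a : nat -> R[i]) : R :=
  Num.sqrt (\sum_(1 <= n < N.+1) cabs (a n) ^+ 2).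

Definition strip (N j : nat) : set (R * R) :=
  [set p | 0 <= p.1 <= 1 /\ (j%:R - 1) / N%:R <= p.2 <= j%:R / N%:R].

Definition dyadic (lambda : R) : Prop := exists k : int, lambda = 2 ^ k.

Definition lesssim (K A B : R) : Prop := A <= K * B.

(* A ~ B, with the two implicit constants K1 and K2 made explicit. *)
Definition sim (K1 K2 A B : R) : Prop := lesssim K1 A B /\ lesssim K2 B A.

(* The ordinal [i : 'I_N] stands for the strip index j = i + 1 in [1, N]. *)
Definition num_strips (K1 K2 : R) (N : nat) (a : nat -> R[i]) (lambda : R)
    : nat :=
  #|[set i : 'I_N | `[< exists2 p : R * R, strip N i.+1 p &
       sim K1 K2 (cabs (expsum N a p.1 p.2)) (lambda * l2norm N a) >] ]%SET|.

End Defs.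

(* Main.v *)
Require Import Defs.
From mathcomp Require Import all_boot all_order all_algebra.
From mathcomp Require Import all_classical all_reals all_analysis.
From mathcomp Require Import ring lra zify.
Import Order.TTheory GRing.Theory Num.Theory.
Import numFieldNormedType.Exports.
Local Open Scope ring_scope.
Set Implicit Arguments.
Unset Strict Implicit.
Unset Printing Implicit Defensive.

(** Choose a point (x_j, t_j) in every counted strip, let J be the set of
    these strips, M its cardinality, e(z) = exp(2 pi i z), and
    u_j(n) = e(n x_j + n^2 t_j).  Two applications of Cauchy-Schwarz
    (lemma [duality]) turn the lower bound on the values of f into
<<
    (sum_j |f(x_j, t_j)|)^4 <= ||a||^4 M^2 E,
    E = sum_{j,k} |<u_j, u_k>|^2
      = sum_{p,q <= N} |sum_j e((p - q) x_j + (p^2 - q^2) t_j)|^2,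
>>
    where the two forms of the energy E agree because each is the squared
    Hilbert-Schmidt norm of a Gram matrix of the same family.  The theorem
    follows from E <= C D N^2 M with D the largest number of divisors of an
    integer below 4 N^2: then M^4 (lambda ||a||)^4 <= C ||a||^4 D N^2 M^3, that
    is, M <= C D N^2 lambda^-4, and D is O(N^eps) by the divisor bound.

    The bound on E is [parabola_energy_le].  The diagonal p = q contributes
    N M^2 <= N^2 M.  Off the diagonal put h = p - q and l = p + q, so that
    p^2 - q^2 = h l and the inner sum is sum_j e(h x_j) e(h l t_j).  For fixed h
    the factor e(h x_j) is a constant phase as l varies.  Completing the sum
    over l to a positive definite sum over differences shows that such a phase
    can be dropped ([sum_powers_remove_phase]): the abscissae x_j disappear, and
    with S(v) = sum_j e(v t_j) there remains the sum of |S(h l)|^2 over h and l.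
    An integer v is a product h l in at most D ways, and the sum of |S(v)|^2
    over v < 4 N^2 is O(N^2 M) by [large_sieve], because points in strips that
    are not neighbours have ordinates at distance at least 1/N modulo 1. *)

(** * The divisor bound *)

(** A divisor d of a b is recovered from gcd(d, a), which divides a, and
    d / gcd(d, a), which divides b. *)
Lemma size_divisors_sub_mul (a b : nat) : (0 < a)%N -> (0 < b)%N ->
  (size (divisors (a * b)) <= size (divisors a) * size (divisors b))%N.
Proof.
move=> a0 b0; rewrite -(size_allpairs pair).
rewrite -(size_map (fun d => (gcdn d a, d %/ gcdn d a)%N)).
apply: uniq_leq_size => [|p /mapP[d]].
  rewrite map_inj_uniq ?divisors_uniq// => d d' [eg eq].
  rewrite -(divnK (dvdn_gcdl d a)) -(divnK (dvdn_gcdl d' a)).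
  by rewrite eq eg.
rewrite -dvdn_divisors ?muln_gt0 ?a0// => dab ->; apply: allpairs_f.
  by rewrite -dvdn_divisors// dvdn_gcdr.
have g0 : (0 < gcdn d a)%N by rewrite gcdn_gt0 a0 orbT.
rewrite -dvdn_divisors// -(@Gauss_dvdr _ (a %/ gcdn d a)); last first.
  rewrite /coprime -(eqn_pmul2r g0) mul1n muln_gcdl.
  by rewrite !divnK ?dvdn_gcdl ?dvdn_gcdr.
rewrite -(dvdn_pmul2r g0) divnK ?dvdn_gcdl// -mulnA [(b * _)%N]mulnC mulnA.
by rewrite divnK ?dvdn_gcdr.
Qed.

Lemma size_divisors_pfactor (p e : nat) : prime p ->
  (size (divisors (p ^ e)) <= e.+1)%N.
Proof.
move=> pp; have -> : e.+1 = size (map (expn p) (iota 0 e.+1)).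
  by rewrite size_map size_iota.
apply: uniq_leq_size (divisors_uniq _) _ => d.
rewrite -dvdn_divisors ?expn_gt0 ?prime_gt0// => /(dvdn_pfactor _ _ pp)[i ie ->].
by apply: map_f; rewrite mem_iota add0n.
Qed.

Lemma size_divisors_prod (s : seq nat) (F : nat -> nat) :
  (forall p, p \in s -> (0 < F p)%N) ->
  (size (divisors (\prod_(p <- s) F p)) <= \prod_(p <- s) size (divisors (F p)))%N.
Proof.
elim: s => [|p s IHs] F0; first by rewrite !big_nil.
rewrite !big_cons; apply: leq_trans (size_divisors_sub_mul _ _) _.
- by rewrite F0 ?mem_head.
- by rewrite big_seq prodn_cond_gt0// => q qs; rewrite F0// inE qs orbT.
- by rewrite leq_mul2l IHs ?orbT// => q qs; rewrite F0// inE qs orbT.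
Qed.

Lemma prod_primes (n : nat) : (0 < n)%N -> n = (\prod_(p <- primes n) p ^ logn p n)%N.
Proof.
by move=> n0; rewrite {1}(prod_prime_decomp n0) prime_decompE big_map.
Qed.

Lemma size_divisors_le_prod (n : nat) : (0 < n)%N ->
  (size (divisors n) <= \prod_(p <- primes n) (logn p n).+1)%N.
Proof.
move=> n0; rewrite [in leqLHS](prod_primes n0).
apply: leq_trans (size_divisors_prod _) _ => [p|].
  by rewrite mem_primes expn_gt0 => /andP[/prime_gt0->].
rewrite big_seq [leqRHS]big_seq; apply: leq_prod => p.
by rewrite mem_primes => /andP[pp _]; apply: size_divisors_pfactor.
Qed.

Section divisor_bound.
Variable R : realType.

Lemma powR_natX (p k : nat) (eps : R) :
  (p ^ k)%:R `^ eps = (p%:R `^ eps) ^+ k :> R.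
Proof. by elim: k => [|k IHk]; rewrite ?expn0 ?powR1// expnS natrM powRM// IHk exprS. Qed.

Lemma powR_prod (s : seq nat) (F : nat -> nat) (eps : R) :
  (\prod_(p <- s) F p)%:R `^ eps = \prod_(p <- s) (F p)%:R `^ eps :> R.
Proof.
by elim: s => [|p s IHs]; rewrite ?big_nil ?powR1// !big_cons natrM powRM// IHs.
Qed.

Lemma succ_le_exp (x : R) (k : nat) : 1 < x ->
  k.+1%:R <= (1 + (x - 1)^-1) * x ^+ k.
Proof.
move=> x1; set d := x - 1; have d0 : 0 < d by rewrite subr_gt0.
have -> : x = 1 + d by rewrite /d addrC subrK.
have bern : 1 + k%:R * d <= (1 + d) ^+ k.
  elim: k => [|k IHk]; first by rewrite mul0r addr0 expr0.
  rewrite exprSr -natr1; apply: le_trans (ler_wpM2r _ IHk); last by lra.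
  have : 0 <= k%:R * (d * d) by rewrite !mulr_ge0// ltW.
  by lra.
have i0 : 0 < d^-1 by rewrite invr_gt0.
apply: le_trans (ler_wpM2l _ bern); last by lra.
have -> : (1 + d^-1) * (1 + k%:R * d) = 1 + d^-1 + k%:R * d + k%:R.
  by field; rewrite gt_eqF.
have : 0 <= k%:R * d by rewrite mulr_ge0// ltW.
by rewrite -natr1; lra.
Qed.

(** With n the product of the p^e, the number of divisors of n is at most the
    product of the e + 1.  Once p^eps >= 2 one has e + 1 <= (p^eps)^e, so only
    the boundedly many primes p < B lose a factor; it is at most A for each of
    them, by Bernoulli's inequality for 2^eps. *)
Lemma divisor_bound (eps : R) : 0 < eps ->
  exists2 C : R, 0 < C & forall n : nat, (0 < n)%N ->
    (size (divisors n))%:R <= C * n%:R `^ eps.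
Proof.
move=> e0; set A : R := 1 + (2 `^ eps - 1)^-1.
have pow2 : 1 < 2 `^ eps :> R.
  by rewrite /powR pnatr_eq0/= -[ltLHS]expR0 ltr_expR mulr_gt0// ln_gt0// ltr1n.
have A1 : 1 <= A by rewrite lerDl invr_ge0 subr_ge0 ltW.
pose B := (Num.trunc (2 `^ eps^-1 : R)).+1.
have big (p : nat) : (B <= p)%N -> 2 <= p%:R `^ eps :> R.
  move=> Bp; have : 2 `^ eps^-1 <= p%:R :> R.
    apply: le_trans (_ : _ <= B%:R) _; last by rewrite ler_nat.
    by rewrite ltW// truncnS_gt.
  move=> /(ge0_ler_powR (ltW e0) (powR_ge0 _ _) (ler0n _ _)).
  by rewrite -powRrM mulVf ?gt_eqF// powRr1.
exists (A ^+ B) => [|n n0]; first by rewrite exprn_gt0// (lt_le_trans ltr01).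
apply: le_trans (_ : _ <= (\prod_(p <- primes n) (logn p n).+1)%:R) _.
  by rewrite ler_nat size_divisors_le_prod.
rewrite {3}(prod_primes n0) powR_prod natr_prod.
apply: le_trans (_ : _ <= \prod_(p <- primes n)
    ((if (p < B)%N then A else 1) * (p ^ logn p n)%:R `^ eps)) _.
  rewrite big_seq [leRHS]big_seq; apply: ler_prod => p.
  rewrite mem_primes ler0n powR_natX => /andP[/prime_gt1 p1 _] /=.
  have [pB|/big p2] := ltnP.
    apply: (le_trans (succ_le_exp (logn p n) pow2)).
    rewrite ler_pM2l ?(lt_le_trans ltr01)// lerXn2r ?nnegrE ?powR_ge0//.
    by rewrite ge0_ler_powR// ?nnegrE ?ler_nat// ltW.
  rewrite mul1r; apply: le_trans (_ : _ <= 2 ^+ logn p n) _.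
    by rewrite -natrX ler_nat ltn_expl.
  by rewrite lerXn2r// ?nnegrE ?powR_ge0.
rewrite big_split /= ler_wpM2r//; first by apply: prodr_ge0 => *; rewrite powR_ge0.
rewrite -big_mkcond big_const_seq iter_mulr_1 ler_weXn2l//.
rewrite -size_filter -[leqRHS](size_iota 0); apply: uniq_leq_size.
  by rewrite filter_uniq// primes_uniq.
by move=> p; rewrite mem_filter mem_iota => /andP[].
Qed.
End divisor_bound.

(** * Sums of nonnegative terms *)

Section sums.
Variable C : numDomainType.

Lemma ler_sum_uniq_sub (T : eqType) (s1 s2 : seq T) (g : T -> C) :
  uniq s1 -> {subset s1 <= s2} -> (forall i, 0 <= g i) ->
  \sum_(i <- s1) g i <= \sum_(i <- s2) g i.
Proof.
move=> + + g0; elim: s1 s2 => [|x s1 IHs] s2 /=.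
  by move=> _ _; rewrite big_nil sumr_ge0.
move=> /andP[xs1 us1] sub; rewrite big_cons.
have xs2 : x \in s2 by rewrite sub// mem_head.
rewrite [leRHS](perm_big _ (perm_to_rem xs2)) big_cons lerD2l IHs// => y ys1.
have := sub y; rewrite inE ys1 orbT (perm_mem (perm_to_rem xs2)) inE.
by case: eqVneq ys1 xs1 => [->->|_ _ _ /(_ isT)].
Qed.

Lemma ler_sum_inj (S T : eqType) (s1 : seq S) (s2 : seq T) (f : S -> T) (g : T -> C) :
  uniq s1 -> {in s1 &, injective f} -> (forall i, i \in s1 -> f i \in s2) ->
  (forall i, 0 <= g i) ->
  \sum_(i <- s1) g (f i) <= \sum_(i <- s2) g i.
Proof.
move=> u1 finj fs g0; rewrite -(big_map f xpredT g); apply: ler_sum_uniq_sub => //.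
  by rewrite map_inj_in_uniq.
by move=> _ /mapP[i /fs + ->].
Qed.

(** Below the diagonal the difference p - q is a natural number, so that it can
    serve as an exponent. *)
Lemma sum_sym (r : seq nat) (H : nat -> nat -> C) : uniq r ->
  (forall p q, H p q = H q p) ->
  \sum_(p <- r) \sum_(q <- r) H p q =
  \sum_(p <- r) H p p + (\sum_(p <- r) \sum_(q <- r | (q < p)%N) H p q) *+ 2.
Proof.
move=> ur Hsym.
have split p : p \in r -> \sum_(q <- r) H p q = H p p +
    (\sum_(q <- r | (q < p)%N) H p q + \sum_(q <- r | (p < q)%N) H p q).
  move=> pr; rewrite (bigD1_seq p)//=; congr (_ + _).
  rewrite (bigID (fun q => q < p)%N)/=; congr (_ + _); apply: eq_bigl => q;
  by rewrite neq_ltn; case: (ltngtP p q).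
rewrite big_seq (eq_bigr _ split) -big_seq !big_split/= mulr2n; congr (_ + (_ + _)).
rewrite (exchange_big_dep xpredT)//=; apply: eq_bigr => p _.
by apply: eq_bigr => q _.
Qed.

(** For fixed h the products h l are distinct multiples of h; then each v is
    counted once for every h that divides it. *)
Lemma sum_products_le_divisors (H L : nat) (D : C) (g : nat -> C) :
  (forall v, 0 <= g v) ->
  (forall v, (0 < v < H * L)%N -> (size (divisors v))%:R <= D) ->
  \sum_(1 <= h < H) \sum_(1 <= l < L) g (h * l)%N <= D * \sum_(1 <= v < H * L) g v.
Proof.
move=> g0 hD.
apply: le_trans (_ : _ <= \sum_(1 <= h < H) \sum_(1 <= v < H * L | (h %| v)%N) g v) _.
  rewrite big_seq [leRHS]big_seq; apply: ler_sum => h.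
  rewrite mem_index_iota => /andP[h0 hH]; rewrite -[leRHS]big_filter.
  apply: (ler_sum_inj (f := muln h)) => //; first exact: iota_uniq.
    by move=> l m _ _ /eqP; rewrite eqn_pmul2l// => /eqP.
  move=> l; rewrite mem_filter !mem_index_iota dvdn_mulr//= muln_gt0 h0/=.
  by move=> /andP[-> lL]; rewrite ltn_mul.
rewrite (exchange_big_dep xpredT)//= mulr_sumr big_seq [leRHS]big_seq.
apply: ler_sum => v; rewrite mem_index_iota => /[dup] /hD vD /andP[v0 _].
rewrite big_const_seq iter_addr_0 -[leLHS]mulr_natl ler_wpM2r//.
apply: le_trans vD; rewrite ler_nat -size_filter.
apply: uniq_leq_size; first by rewrite filter_uniq ?iota_uniq.
by move=> h; rewrite mem_filter -dvdn_divisors// => /andP[].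
Qed.
End sums.

(** * Duality and Gram matrices *)

Section duality.
Variable C : numClosedFieldType.

Lemma cauchy_schwarz (T : Type) (r : seq T) (P : pred T) (a b : T -> C) :
  `|\sum_(i <- r | P i) a i * b i| ^+ 2 <=
  (\sum_(i <- r | P i) `|a i| ^+ 2) * (\sum_(i <- r | P i) `|b i| ^+ 2).
Proof.
set A := \sum_(i <- r | P i) `|a i| ^+ 2; set B := \sum_(i <- r | P i) `|b i| ^+ 2.
set S := \sum_(i <- r | P i) a i * b i.
(* Lagrange's identity. *)
have : 0 <= \sum_(i <- r | P i) \sum_(j <- r | P j)
    `|a i * (b j)^* - a j * (b i)^*| ^+ 2.
  by apply: sumr_ge0 => i _; apply: sumr_ge0 => j _; rewrite exprn_ge0.
have -> : \sum_(i <- r | P i) \sum_(j <- r | P j)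
    `|a i * (b j)^* - a j * (b i)^*| ^+ 2 = (A * B - `|S| ^+ 2) *+ 2.
  have -> : `|S| ^+ 2 = \sum_(i <- r | P i) \sum_(j <- r | P j)
       (a i * b i) * ((a j)^* * (b j)^*).
    rewrite normCK rmorph_sum mulr_suml; apply: eq_bigr => i _.
    by rewrite mulr_sumr; apply: eq_bigr => j _; rewrite rmorphM.
  have -> : A * B = \sum_(i <- r | P i) \sum_(j <- r | P j)
      `|a i| ^+ 2 * `|b j| ^+ 2.
    by rewrite mulr_suml; apply: eq_bigr => i _; rewrite mulr_sumr.
  rewrite mulr2n -sumrB.
  under [X in _ = X + _]eq_bigr => i _ do rewrite -sumrB.
  under [X in _ = _ + X]eq_bigr => i _ do rewrite -sumrB.
  rewrite [X in _ = _ + X]exchange_big/= -big_split/=; apply: eq_bigr => i _.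
  rewrite -big_split; apply: eq_bigr => j _ /=.
  by rewrite !normCK !(rmorphB, rmorphM)/= !conjCK; ring.
by rewrite pmulrn_lge0// subr_ge0.
Qed.

Variables (I : finType) (J : {set I}).

Lemma sqr_norm_sum (T : Type) (r : seq T) (c : I -> C) (u : I -> T -> C) :
  \sum_(n <- r) `|\sum_(j in J) c j * u j n| ^+ 2 =
  \sum_(j in J) \sum_(k in J) c j * (c k)^* * \sum_(n <- r) u j n * (u k n)^*.
Proof.
transitivity (\sum_(n <- r) \sum_(j in J) \sum_(k in J)
    (c j * (c k)^* * (u j n * (u k n)^*))).
  apply: eq_bigr => n _; rewrite normCK rmorph_sum mulr_suml.
  apply: eq_bigr => j _; rewrite mulr_sumr; apply: eq_bigr => k _.
  by rewrite !rmorphM/=; ring.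
rewrite exchange_big/=; apply: eq_bigr => j _.
rewrite exchange_big/=; apply: eq_bigr => k _.
by rewrite mulr_sumr.
Qed.

Lemma sqr_norm_sum_le (T : Type) (r : seq T) (c : I -> C) (u : I -> T -> C) :
  (forall j, `|c j| = 1) ->
  \sum_(n <- r) `|\sum_(j in J) c j * u j n| ^+ 2 <=
  \sum_(j in J) \sum_(k in J) `|\sum_(n <- r) u j n * (u k n)^*|.
Proof.
move=> c1; rewrite -[leLHS]ger0_norm; last first.
  by apply: sumr_ge0 => n _; rewrite exprn_ge0.
rewrite sqr_norm_sum; apply: le_trans (ler_norm_sum _ _ _) _.
apply: ler_sum => j _; apply: le_trans (ler_norm_sum _ _ _) _.
by apply: ler_sum => k _; rewrite 2!normrM norm_conjC !c1 !mul1r.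
Qed.

(** The Gram matrix of the vectors u_j(p) conj(u_j(q)), indexed by pairs (p, q),
    is the entrywise squared modulus of the Gram matrix of the u_j.  The next
    two lemmas apply the expansion of a squared norm to these vectors. *)
Lemma sum_pair_gram (r : seq nat) (u : I -> nat -> C) (j k : I) :
  \sum_(x <- [seq (p, q) | p <- r, q <- r])
     (u j x.1 * (u j x.2)^*) * (u k x.1 * (u k x.2)^*)^* =
  `|\sum_(p <- r) u j p * (u k p)^*| ^+ 2.
Proof.
rewrite big_allpairs normCK rmorph_sum mulr_suml; apply: eq_bigr => p _.
rewrite mulr_sumr; apply: eq_bigr => q _ /=.
by rewrite !rmorphM/= !conjCK; ring.
Qed.

Lemma gram_swap (r : seq nat) (u : I -> nat -> C) :
  \sum_(p <- r) \sum_(q <- r) `|\sum_(j in J) u j p * (u j q)^*| ^+ 2 =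
  \sum_(j in J) \sum_(k in J) `|\sum_(p <- r) u j p * (u k p)^*| ^+ 2.
Proof.
have := sqr_norm_sum [seq (p, q) | p <- r, q <- r] (fun=> 1)
  (fun j x => u j x.1 * (u j x.2)^*).
rewrite big_allpairs/= => swap.
transitivity (\sum_(p <- r) \sum_(q <- r)
   `|\sum_(j in J) 1 * (u j p * (u j q)^*)| ^+ 2).
  apply: eq_bigr => p _; apply: eq_bigr => q _.
  by under [in RHS]eq_bigr do rewrite mul1r.
rewrite swap; apply: eq_bigr => j _; apply: eq_bigr => k _.
by rewrite conjC1 !mul1r sum_pair_gram.
Qed.

(** By [sum_pair_gram], the expansion of the left-hand side has nonnegative
    Gram coefficients, so that its largest value over unimodular b is reached
    at b = 1. *)
Lemma gram_phase_le (r : seq nat) (b : I -> C) (u : I -> nat -> C) :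
  (forall j, `|b j| = 1) ->
  \sum_(p <- r) \sum_(q <- r) `|\sum_(j in J) b j * (u j p * (u j q)^*)| ^+ 2 <=
  \sum_(p <- r) \sum_(q <- r) `|\sum_(j in J) u j p * (u j q)^*| ^+ 2.
Proof.
move=> b1; rewrite gram_swap.
have := sqr_norm_sum_le [seq (p, q) | p <- r, q <- r]
  (fun j x => u j x.1 * (u j x.2)^*) b1.
rewrite big_allpairs/= => /le_trans; apply.
apply: ler_sum => j _; apply: ler_sum => k _.
by rewrite sum_pair_gram ger0_norm ?exprn_ge0.
Qed.

(** With phases c_j such that c_j f_j = |f_j|, Cauchy-Schwarz in n removes the
    coefficients a_n and leaves the sum of the |G j k| over the Gram matrix G;
    Cauchy-Schwarz in (j, k) then passes to squares, to which [gram_swap]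
    applies. *)
Lemma duality (r : seq nat) (a : nat -> C) (u : I -> nat -> C) :
  (\sum_(j in J) `|\sum_(n <- r) a n * u j n|) ^+ 4 <=
  (\sum_(n <- r) `|a n| ^+ 2) ^+ 2 * #|J|%:R ^+ 2 *
    \sum_(p <- r) \sum_(q <- r) `|\sum_(j in J) u j p * (u j q)^*| ^+ 2.
Proof.
set F := \sum_(j in J) _; set A := \sum_(n <- r) `|a n| ^+ 2.
pose f j := \sum_(n <- r) a n * u j n.
pose c j : C := if f j == 0 then 1 else `|f j| / f j.
have c1 j : `|c j| = 1.
  rewrite /c; case: eqVneq => [_|fj0]; first by rewrite normr1.
  by rewrite normrM normrV ?unitfE// normr_id divff ?normr_eq0.
have cf j : c j * f j = `|f j|.
  by rewrite /c; case: eqVneq => [->|fj0]; rewrite ?mulr0 ?normr0// divfK.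
have A0 : 0 <= A by apply: sumr_ge0 => n _; rewrite exprn_ge0.
have F0 : 0 <= F by apply: sumr_ge0.
pose G j k := \sum_(n <- r) u j n * (u k n)^*.
have FE : F = \sum_(n <- r) a n * \sum_(j in J) c j * u j n.
  transitivity (\sum_(j in J) c j * f j); first by apply: eq_bigr => j _; rewrite cf.
  under eq_bigr => j _ do rewrite mulr_sumr.
  rewrite exchange_big/=; apply: eq_bigr => n _; rewrite mulr_sumr.
  by apply: eq_bigr => j _; rewrite mulrCA.
have F2 : F ^+ 2 <= A * \sum_(j in J) \sum_(k in J) `|G j k|.
  rewrite -(ger0_norm F0) FE; apply: le_trans (cauchy_schwarz _ _ _ _) _.
  by rewrite ler_wpM2l// sqr_norm_sum_le.
have G2 : (\sum_(j in J) \sum_(k in J) `|G j k|) ^+ 2 <=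
    #|J|%:R ^+ 2 * \sum_(j in J) \sum_(k in J) `|G j k| ^+ 2.
  rewrite !pair_big/=.
  set P := (fun p : I * I => (p.1 \in J) && (p.2 \in J)).
  have := cauchy_schwarz (index_enum (I * I)%type) P (fun=> 1) (fun p => `|G p.1 p.2|).
  have -> : \sum_(p | P p) 1 * `|G p.1 p.2| = \sum_(p | P p) `|G p.1 p.2|.
    by apply: eq_bigr => p _; rewrite mul1r.
  rewrite ger0_norm ?sumr_ge0// => /le_trans; apply.
  under [X in _ * X <= _]eq_bigr => p _ do rewrite normr_id.
  rewrite -(pair_big (mem J) (mem J) (fun _ _ => `|1| ^+ 2))/= normr1 expr1n.
  by rewrite !sumr_const -mulrnA natrM expr2.
rewrite (exprM _ 2 2); apply: le_trans (lerXn2r 2 _ _ F2) _.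
- by rewrite nnegrE exprn_ge0.
- by rewrite nnegrE mulr_ge0// sumr_ge0// => j _; rewrite sumr_ge0.
by rewrite exprMn -mulrA ler_wpM2l ?exprn_ge0// gram_swap.
Qed.
End duality.

(** * Power sums of unimodular numbers *)

Section exponential_sums.
Variables (C : numClosedFieldType) (I : finType) (J : {set I}).

Lemma unit_expM_conj (z : C) (p q : nat) : `|z| = 1 -> (q <= p)%N ->
  z ^+ p * (z ^+ q)^* = z ^+ (p - q).
Proof.
move=> z1 qp; rewrite -{1}(subnK qp) exprD -mulrA -normCK normrX z1 !expr1n.
by rewrite mulr1.
Qed.

Lemma norm_sum_unit_le (z : I -> C) : (forall j, `|z j| = 1) ->
  `|\sum_(j in J) z j| <= #|J|%:R.
Proof.
move=> z1; apply: le_trans (ler_norm_sum _ _ _) _.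
by under eq_bigr => j _ do rewrite z1; rewrite sumr_const.
Qed.

(** Completion of the sum: every l < L is a difference p - q with p, q < 2 L in
    at least L ways, one for each q < L. *)
Lemma sum_powers_le_differences (z b : I -> C) (L : nat) : (forall j, `|z j| = 1) ->
  L%:R * \sum_(0 <= l < L) `|\sum_(j in J) b j * z j ^+ l| ^+ 2 <=
  \sum_(0 <= p < 2 * L) \sum_(0 <= q < 2 * L)
    `|\sum_(j in J) b j * (z j ^+ p * (z j ^+ q)^*)| ^+ 2.
Proof.
move=> z1; rewrite exchange_big/= mul2n -addnn.
rewrite [leRHS](big_cat_nat (leq0n L) (leq_addr L L))/= -[leLHS]addr0.
apply: lerD; last first.
  by apply: sumr_ge0 => q _; apply: sumr_ge0 => p _; rewrite exprn_ge0.
rewrite -[L in L%:R]subn0 mulr_natl -sumr_const_nat [leLHS]big_seq [leRHS]big_seq.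
apply: ler_sum => q; rewrite mem_index_iota /= => qL.
rewrite [leLHS](_ : _ = \sum_(0 <= l < L)
    `|\sum_(j in J) b j * (z j ^+ (q + l) * (z j ^+ q)^*)| ^+ 2); last first.
  apply: eq_bigr => l _; congr (`|_| ^+ 2); apply: eq_bigr => j _.
  by rewrite unit_expM_conj ?leq_addr// addKn.
apply: (ler_sum_inj (f := addn q)
  (g := fun p => `|\sum_(j in J) b j * (z j ^+ p * (z j ^+ q)^*)| ^+ 2)).
- exact: iota_uniq.
- by move=> l m _ _ /addnI.
- by move=> l; rewrite !mem_index_iota/= => lL; rewrite -addnS leq_add// ltnW.
- by move=> l; rewrite exprn_ge0.
Qed.

Lemma sum_differences_le_powers (z : I -> C) (P : nat) : (forall j, `|z j| = 1) ->
  \sum_(0 <= p < P) \sum_(0 <= q < P) `|\sum_(j in J) z j ^+ p * (z j ^+ q)^*| ^+ 2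
  <= P%:R * (#|J|%:R ^+ 2 + (\sum_(1 <= l < P) `|\sum_(j in J) z j ^+ l| ^+ 2) *+ 2).
Proof.
move=> z1; rewrite sum_sym ?iota_uniq//; last first.
  move=> p q; rewrite -[in LHS]norm_conjC rmorph_sum; congr (`|_| ^+ 2).
  by apply: eq_bigr => j _; rewrite rmorphM/= conjCK mulrC.
rewrite mulrDr mulrnAr -[P in P%:R]subn0 !mulr_natl -!sumr_const_nat.
apply: lerD; first apply: ler_sum => p _.
  rewrite lerXn2r ?nnegrE ?normr_ge0// ?ler0n//.
  by apply: norm_sum_unit_le => j; rewrite normrM norm_conjC normrX z1 expr1n mulr1.
rewrite lerMn2r/= [leLHS]big_seq [leRHS]big_seq; apply: ler_sum => p.
rewrite mem_index_iota /= => pP.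
rewrite -big_filter big_seq.
rewrite (eq_bigr (fun q => `|\sum_(j in J) z j ^+ (p - q)| ^+ 2)) => [|q]; last first.
  rewrite mem_filter => /andP[qp _]; congr (`|_| ^+ 2); apply: eq_bigr => j _.
  by rewrite unit_expM_conj// ltnW.
rewrite -big_seq; apply: (ler_sum_inj (f := subn p)
   (g := fun l => `|\sum_(j in J) z j ^+ l| ^+ 2)).
- by rewrite filter_uniq ?iota_uniq.
- move=> q q'; rewrite !mem_filter => /andP[/ltnW qp _] /andP[/ltnW q'p _] e.
  by rewrite -(subKn qp) e subKn.
- move=> q; rewrite mem_filter !mem_index_iota subn_gt0 => /andP[-> _] /=.
  exact: leq_ltn_trans (leq_subr _ _) pP.
- by move=> l; rewrite exprn_ge0.
Qed.

(** The sum over differences p - q, unlike the sum over powers l, is maximal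
    when the phases b_j are trivial. *)
Lemma sum_powers_remove_phase (z b : I -> C) (L : nat) : (0 < L)%N ->
  (forall j, `|z j| = 1) -> (forall j, `|b j| = 1) ->
  \sum_(0 <= l < L) `|\sum_(j in J) b j * z j ^+ l| ^+ 2 <=
  (#|J|%:R ^+ 2) *+ 2 + (\sum_(1 <= l < 2 * L) `|\sum_(j in J) z j ^+ l| ^+ 2) *+ 4.
Proof.
move=> L0 z1 b1; rewrite -(ler_pM2l (_ : 0 < L%:R)) ?ltr0n//.
apply: (le_trans (sum_powers_le_differences b L z1)).
apply: (le_trans (gram_phase_le _ _ (fun j p => z j ^+ p) b1)).
apply: (le_trans (sum_differences_le_powers (2 * L) z1)).
by rewrite natrM le_eqVlt; apply/orP; left; apply/eqP; ring.
Qed.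

Lemma geometric_sum_le (w : C) (P : nat) : `|w| = 1 ->
  `|1 - w| * `|\sum_(0 <= p < P) w ^+ p| <= 2.
Proof.
move=> w1; rewrite distrC -normrM big_mkord -subrX1.
apply: le_trans (ler_normB _ _) _.
by rewrite normrX w1 expr1n normr1.
Qed.

Variables (N : nat) (far : rel I).

(** After completion and [gram_swap], the pair (j, k) contributes the squared
    modulus of a geometric sum of length 2 V and ratio z_j conj(z_k).  It is at
    most (2 V)^2, used for the at most five k close to j, and at most N^2 when
    the ratio is at distance at least 2 / N from 1. *)
Lemma large_sieve (z : I -> C) (V : nat) : (0 < V)%N ->
  (forall j, `|z j| = 1) ->
  (forall j, j \in J -> (#|[set k in J | ~~ far j k]| <= 5)%N) ->
  (forall j k, j \in J -> k \in J -> far j k -> 2 <= N%:R * `|1 - z j * (z k)^*|) ->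
  V%:R * \sum_(0 <= v < V) `|\sum_(j in J) z j ^+ v| ^+ 2 <=
    #|J|%:R * (20 * V%:R ^+ 2 + #|J|%:R * N%:R ^+ 2).
Proof.
move=> V0 z1 near hfar.
have := sum_powers_le_differences (fun=> 1) V z1.
under eq_bigr do under eq_bigr do rewrite mul1r.
under [X in _ <= X]eq_bigr do under eq_bigr do under eq_bigr do rewrite mul1r.
move=> /le_trans; apply; rewrite gram_swap.
rewrite mulr_natl -sumr_const; apply: ler_sum => j jJ.
rewrite (bigID (far j))/= addrC; apply: lerD.
  apply: le_trans (_ : _ <= \sum_(k in J | ~~ far j k) (2 * V)%:R ^+ 2) _.
    apply: ler_sum => k _; rewrite lerXn2r ?nnegrE ?normr_ge0 ?ler0n//.
    apply: le_trans (ler_norm_sum _ _ _) _.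
    under eq_bigr => p _ do rewrite normrM norm_conjC !normrX !z1 expr1n mulr1.
    by rewrite sumr_const_nat subn0.
  rewrite sumr_const; apply: le_trans (_ : _ <= (2 * V)%:R ^+ 2 *+ 5) _.
    rewrite ler_wpMn2l ?exprn_ge0 ?ler0n//.
    by have := near j jJ; rewrite cardsE.
  by rewrite natrM le_eqVlt; apply/orP; left; apply/eqP; ring.
apply: le_trans (_ : _ <= \sum_(k in J) N%:R ^+ 2) _; last first.
  by rewrite sumr_const mulr_natl.
rewrite big_mkcondr/=; apply: ler_sum => k kJ; case: ifPn => [fjk|_]; last first.
  by rewrite exprn_ge0.
rewrite lerXn2r ?nnegrE ?normr_ge0 ?ler0n//.
set w := z j * (z k)^*; have w1 : `|w| = 1 by rewrite normrM norm_conjC !z1 mulr1.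
rewrite (eq_bigr (fun p => w ^+ p)) => [|p _]; last by rewrite exprMn rmorphXn.
have w0 : 0 < `|1 - w|.
  rewrite lt_def normr_ge0 andbT; apply/eqP => w0.
  by have := hfar j k jJ kJ fjk; rewrite w0 mulr0 lern0.
rewrite -(ler_pM2l w0); apply: le_trans (geometric_sum_le _ w1) _.
by rewrite mulrC hfar.
Qed.

(** Here x_j and y_j stand for e(x_j) and e(t_j).  The constant is 5 for the
    terms N M^2 (one on the diagonal and four from removing the phases) plus
    2 * 4 * 81 for the two halves of the off-diagonal part, the factor of
    [sum_powers_remove_phase] and the large sieve. *)
Lemma parabola_energy_le (x y : I -> C) (D : C) : (0 < N)%N ->
  (forall j, `|x j| = 1) -> (forall j, `|y j| = 1) -> (#|J| <= N)%N ->
  (forall j, j \in J -> (#|[set k in J | ~~ far j k]| <= 5)%N) ->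
  (forall j k, j \in J -> k \in J -> far j k -> 2 <= N%:R * `|1 - y j * (y k)^*|) ->
  (forall v, (0 < v < N * (4 * N))%N -> (size (divisors v))%:R <= D) ->
  \sum_(1 <= p < N.+1) \sum_(1 <= q < N.+1)
    `|\sum_(j in J) (x j ^+ p * y j ^+ (p ^ 2)) * (x j ^+ q * y j ^+ (q ^ 2))^*| ^+ 2
  <= 653 * D * N%:R ^+ 2 * #|J|%:R.
Proof.
move=> N0 x1 y1 JN near hfar hD.
set M : C := #|J|%:R; have M0 : 0 <= M by rewrite ler0n.
have N1 : 1 <= N%:R :> C by rewrite ler1n.
have MN : M <= N%:R by rewrite ler_nat.
have D1 : 1 <= D.
  apply: le_trans (hD 1%N _) => //=; rewrite mulnCA.
  by rewrite (@leq_trans (4 * 1))// leq_mul2l/= muln_gt0 N0.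
have xy1 j p q : `|x j ^+ p * y j ^+ q| = 1.
  by rewrite normrM !normrX x1 y1 !expr1n mulr1.
pose S v := `|\sum_(j in J) y j ^+ v| ^+ 2.
have S0 v : 0 <= S v by rewrite exprn_ge0.
have sieve : \sum_(1 <= v < N * (4 * N)) S v <= 81 * N%:R ^+ 2 * M.
  have V0 : (0 < N * (4 * N))%N by rewrite !muln_gt0 N0.
  apply: le_trans (_ : _ <= \sum_(0 <= v < N * (4 * N)) S v) _.
    by rewrite [leRHS]big_ltn// lerDr.
  rewrite -(ler_pM2l (_ : 0 < (N * (4 * N))%:R)) ?ltr0n//.
  apply: (le_trans (large_sieve V0 y1 near hfar)); rewrite -/M !natrM.
  have -> : (N%:R * (4 * N%:R)) * (81 * N%:R ^+ 2 * M) =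
    M * (20 * (N%:R * (4 * N%:R)) ^+ 2 + N%:R ^+ 2 * (4 * N%:R ^+ 2)) by ring.
  rewrite ler_wpM2l// lerD2l mulrC ler_wpM2l ?exprn_ge0 ?ler0n//.
  rewrite -natrX -natrM ler_nat (leq_trans JN)// mulnC expnS expn1 -mulnA.
  by rewrite leq_pmulr// !muln_gt0 N0.
(* The map (p, q) |-> (p - q, p + q) is injective. *)
have off : \sum_(1 <= p < N.+1) \sum_(1 <= q < N.+1 | (q < p)%N)
    `|\sum_(j in J) (x j ^+ p * y j ^+ (p ^ 2)) * (x j ^+ q * y j ^+ (q ^ 2))^*| ^+ 2
    <= \sum_(1 <= h < N) \sum_(0 <= l < 2 * N)
      `|\sum_(j in J) x j ^+ h * (y j ^+ h) ^+ l| ^+ 2.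
  pose g (hl : nat * nat) := `|\sum_(j in J) x j ^+ hl.1 * (y j ^+ hl.1) ^+ hl.2| ^+ 2.
  pose r := index_iota 1 N.+1.
  pose s := [seq pq <- [seq (p, q) | p <- r, q <- r] | (pq.2 < pq.1)%N].
  have sE p q : (p, q) \in s -> [/\ (0 < q)%N, (q < p)%N & (p <= N)%N].
    rewrite mem_filter => /andP[/= -> /allpairsP[[p' q'] [/= + + [-> ->]]]].
    by rewrite !mem_index_iota ltnS => /andP[_ ->] /andP[-> _].
  have -> : \sum_(1 <= h < N) \sum_(0 <= l < 2 * N)
      `|\sum_(j in J) x j ^+ h * (y j ^+ h) ^+ l| ^+ 2 =
      \sum_(hl <- [seq (h, l) | h <- index_iota 1 N, l <- index_iota 0 (2 * N)]) g hl.
    by rewrite big_allpairs.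
  have -> : \sum_(1 <= p < N.+1) \sum_(1 <= q < N.+1 | (q < p)%N)
    `|\sum_(j in J) (x j ^+ p * y j ^+ (p ^ 2)) * (x j ^+ q * y j ^+ (q ^ 2))^*| ^+ 2
    = \sum_(pq <- s) g (pq.1 - pq.2, pq.1 + pq.2)%N.
    rewrite big_filter [RHS]big_mkcond big_allpairs; apply: eq_bigr => p _.
    rewrite [LHS]big_mkcond; apply: eq_bigr => q _ /=; case: ifPn => // qp.
    congr (`|_| ^+ 2); apply: eq_bigr => j _.
    rewrite rmorphM/= mulrACA !unit_expM_conj ?leq_sqr 1?ltnW// -exprM.
    by rewrite subn_sqr.
  apply: (ler_sum_inj (f := fun pq : nat * nat => (pq.1 - pq.2, pq.1 + pq.2)%N)).
  - by rewrite filter_uniq// allpairs_uniq ?iota_uniq// => -[p q] [p' q'].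
  - move=> [p q] [p' q'] /sE[_ qp _] /sE[_ qp' _] /= [e1 e2].
    by congr (_, _); lia.
  - move=> [p q] /sE[q0 qp pN] /=; apply: allpairs_f; rewrite mem_index_iota; lia.
  - by move=> hl; rewrite exprn_ge0.
have offN : \sum_(1 <= h < N) \sum_(0 <= l < 2 * N)
      `|\sum_(j in J) x j ^+ h * (y j ^+ h) ^+ l| ^+ 2 <= N%:R * M ^+ 2 *+ 2 +
      (D * (81 * N%:R ^+ 2 * M)) *+ 4.
  apply: le_trans (_ : _ <= \sum_(1 <= h < N) (M ^+ 2 *+ 2 +
     (\sum_(1 <= l < 4 * N) S (h * l)%N) *+ 4)) _.
    apply: ler_sum => h _.
    apply: (le_trans (@sum_powers_remove_phase (fun j => y j ^+ h)
      (fun j => x j ^+ h) (2 * N) _ _ _)).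
    - by rewrite muln_gt0 N0.
    - by move=> j; rewrite normrX y1 expr1n.
    - by move=> j; rewrite normrX x1 expr1n.
    rewrite mulnA lerD2l lerMn2r/= le_eqVlt; apply/orP; left; apply/eqP.
    by apply: eq_bigr => l _; congr (`|_| ^+ 2); apply: eq_bigr => j _; rewrite exprM.
  rewrite big_split/=; apply: lerD.
    rewrite sumr_const_nat -mulrnA mulnC mulrnA lerMn2r/= -[leLHS]mulr_natl.
    by rewrite ler_wpM2r ?exprn_ge0// ler_nat leq_subr.
  rewrite sumrMnl lerMn2r/=; apply: (le_trans (sum_products_le_divisors S0 hD)).
  by rewrite ler_wpM2l// (le_trans ler01).
rewrite sum_sym ?iota_uniq//; last first.
  move=> p q; rewrite -[in LHS]norm_conjC rmorph_sum; congr (`|_| ^+ 2).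
  by apply: eq_bigr => j _; rewrite rmorphM/= conjCK mulrC.
apply: le_trans (_ : _ <= N%:R * M ^+ 2 + (N%:R * M ^+ 2 *+ 2 +
      (D * (81 * N%:R ^+ 2 * M)) *+ 4) *+ 2) _.
  apply: lerD; last by rewrite lerMn2r/= (le_trans off).
  rewrite -[N in N%:R]subn0 -subSS mulr_natl -sumr_const_nat; apply: ler_sum => p _.
  rewrite lerXn2r ?nnegrE ?normr_ge0//.
  by apply: norm_sum_unit_le => j; rewrite normrM norm_conjC xy1 mulr1.
have -> : N%:R * M ^+ 2 + (N%:R * M ^+ 2 *+ 2 + (D * (81 * N%:R ^+ 2 * M)) *+ 4) *+ 2
   = 5 * (N%:R * M * M) + 648 * D * N%:R ^+ 2 * M by ring.
have -> : 653 * D * N%:R ^+ 2 * M = 5 * (D * (N%:R ^+ 2 * M)) + 648 * D * N%:R ^+ 2 * M.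
  by ring.
rewrite lerD2r ler_wpM2l//.
apply: le_trans (_ : _ <= N%:R ^+ 2 * M) _; last first.
  by rewrite ler_peMl// mulr_ge0// exprn_ge0.
by rewrite expr2 -!mulrA ler_wpM2l// ler_wpM2r.
Qed.
End exponential_sums.

(** * Characters and spacing of the strips *)

Section characters.
Variable R : realType.
Implicit Types x y : R.
Local Open Scope complex_scope.

Lemma e1D x y : e1 (x + y) = e1 x * e1 y.
Proof.
rewrite /e1 mulrDr cosD sinD; apply/eqP; rewrite eq_complex/=.
by rewrite eqxx/= addrC eqxx.
Qed.

Lemma e1_natM n x : e1 (n%:R * x) = e1 x ^+ n.
Proof.
elim: n => [|n IHn]; last by rewrite -natr1 mulrDl mul1r e1D IHn exprSr.
by rewrite mul0r expr0 /e1 mulr0 cos0 sin0.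
Qed.

Lemma norm_e1 x : `|e1 x| = 1.
Proof. by rewrite normc_def/= cos2Dsin2 sqrtr1. Qed.

Lemma conj_e1 x : (e1 x)^*%R = e1 (- x).
Proof. by rewrite /e1 mulrN cosN sinN. Qed.

Lemma norm_cabs (z : R[i]) : `|z| = (cabs z)%:C.
Proof. by rewrite /cabs normc_def. Qed.

(** The mean value theorem gives x / 2 up to pi / 4, where the cosine is at
    least 1 / 2; beyond, the sine is at least sin(pi / 4) >= 1 / 2. *)
Lemma sin_ge_half x : 0 <= x <= pi / 2 -> Num.min (x / 2) (1 / 2) <= sin x.
Proof.
move=> /andP[x0 xpi].
have pi0 := pi_gt0 R.
have c4 : 1 / 2 <= cos (pi / 4 : R).
  have := cos_mulr2n (pi / 4 : R); rewrite (_ : pi / 4 *+ 2 = pi / 2 :> R); last by field.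
  have : 0 <= cos (pi / 4 : R) by apply: cos_ge0_pihalf; lra.
  rewrite cos_pihalf; nra.
have [x4|x4] := leP x (pi / 4); last first.
  rewrite ge_min; apply/orP; right.
  have : sin (pi / 4 : R) = cos (pi / 4 : R).
    by rewrite -cosBpihalf -cosN; congr cos; field.
  have : sin (pi / 4 : R) < sin x by rewrite ltr_sin ?in_itv/=; lra.
  lra.
rewrite ge_min; apply/orP; left.
move: x0; rewrite le_eqVlt => /predU1P[<-|x0]; first by rewrite sin0 mul0r.
have dsin y : y \in `]0, x[%R -> is_derive y 1 (@sin R) (cos y).
  by move=> _; exact: is_derive_sin.
have csin : {within `[0, x], continuous (@sin R)}%classic.
  by apply: continuous_subspaceT => y; exact: continuous_sin.
have [c] := MVT x0 dsin csin.
rewrite in_itv/= sin0 !subr0 => /andP[c0 cx] ->.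
have : cos (pi / 4 : R) <= cos c by rewrite ltW// ltr_cos ?in_itv/=; lra.
nra.
Qed.

Lemma sin_pi_ge x (d : R) : 0 <= d -> d <= x <= 1 - d -> d <= sin (pi * x).
Proof.
move=> d0; wlog x2 : x / x <= 1 / 2 => [H dx|/andP[dx xd]].
  have [|x2] := leP x (1 / 2); first by move=> /H; apply.
  have -> : sin (pi * x) = sin (pi * (1 - x)) :> R.
    by rewrite mulrBr mulr1 addrC sinDpi sinN opprK.
  by apply: H; lra.
have pi2 := pi_ge2 R.
have := @sin_ge_half (pi * x); rewrite ge_min => H.
have /H/orP[] : 0 <= pi * x <= pi / 2 by nra.
  nra.
nra.
Qed.

(** The chord has length 2 |sin(pi x)|. *)
Lemma chord_e1 x (d : R) : 0 <= d -> d <= x <= 1 - d -> (2 * d)%:C <= `|1 - e1 x|.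
Proof.
move=> d0 dx; have sd := sin_pi_ge d0 dx.
rewrite normc_def lecR/= -(ler_sqr _ _); rewrite ?nnegrE ?sqrtr_ge0 ?mulr_ge0//.
rewrite sqr_sqrtr ?addr_ge0 ?sqr_ge0//.
have c2 : cos (2 * pi * x) = 1 - 2 * sin (pi * x) ^+ 2 :> R.
  have -> : 2 * pi * x = (pi * x) *+ 2 :> R by ring.
  rewrite cos_mulr2n cos2sin2; ring.
have := cos2Dsin2 (2 * pi * x).
have : d ^+ 2 <= sin (pi * x) ^+ 2 by rewrite ler_sqr ?nnegrE//; lra.
rewrite c2; nra.
Qed.

(** The distance of the indices is measured modulo N, since e1 has period 1:
    the first and the last strip are neighbours. *)
Definition far_strips (N : nat) (i k : 'I_N) : bool :=
  ((i + 2 <= k <= i + N - 2) || (k + 2 <= i <= k + N - 2))%N.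

Lemma card_near_strips (N : nat) (J : {set 'I_N}) (i : 'I_N) :
  (#|[set k in J | ~~ far_strips i k]| <= 5)%N.
Proof.
rewrite cardE -(size_map val).
apply: (@uniq_leq_size _ _ [:: i : nat; i.-1; i.+1; i + N - 1; i - (N - 1)]%N).
  by rewrite map_inj_uniq ?enum_uniq//; exact: val_inj.
move=> _ /mapP[k + ->]; rewrite mem_enum inE => /andP[_].
rewrite /far_strips !inE; have := ltn_ord i; have := ltn_ord k => /=.
lia.
Qed.

Lemma far_strips_chord (N : nat) (i k : 'I_N) (s t : R) :
  i%:R / N%:R <= s <= i.+1%:R / N%:R -> k%:R / N%:R <= t <= k.+1%:R / N%:R ->
  far_strips i k -> 2 <= N%:R * `|1 - e1 s * (e1 t)^*%R|.
Proof.
have N0 : 0 < N%:R :> R by rewrite ltr0n (leq_ltn_trans _ (ltn_ord i)).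
wlog ik : i k s t / (i + 2 <= k <= i + N - 2)%N => [H hs ht|hs ht _].
  case/orP => [ik|ki]; first by apply: (H i k s t) => //; rewrite /far_strips ik.
  rewrite -norm_conjC rmorphB rmorph1 rmorphM/= conjCK [X in 1 - X]mulrC.
  by apply: (H k i t s) => //; rewrite /far_strips ki.
have dist : N%:R^-1 <= t - s <= 1 - N%:R^-1.
  move: hs ht; rewrite !ler_pdivrMr// !ler_pdivlMr// => /andP[s1 s2] /andP[t1 t2].
  have [k1 k2] : i.+1%:R + 1 <= k%:R :> R /\ k.+1%:R + 1 <= i%:R + N%:R :> R.
    by rewrite !natr1 -natrD !ler_nat; lia.
  have NN : N%:R^-1 * N%:R = 1 :> R by rewrite mulVf ?gt_eqF.
  by rewrite -(ler_pM2r N0) -[X in _ && X](ler_pM2r N0) !mulrBl NN mul1r; lra.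
rewrite -norm_conjC rmorphB rmorph1 rmorphM/= conjCK conj_e1 -e1D [- s + t]addrC.
have := chord_e1 (ltW (_ : 0 < N%:R^-1)) dist; rewrite invr_gt0 N0 => /(_ isT).
have N0C : 0 < N%:R :> R[i] by rewrite ltr0n -(ltr0n R).
rewrite -(ler_pM2l N0C); apply: le_trans.
by rewrite rmorphM fmorphV !rmorph_nat mulrCA mulfV ?gt_eqF// mulr1.
Qed.

(** * Counting the strips *)

Lemma large_values_bound (N : nat) (J : {set 'I_N}) (pt : 'I_N -> R * R)
    (a : nat -> R[i]) (D H : R) : (0 < N)%N ->
  (forall v, (0 < v < N * (4 * N))%N -> (size (divisors v))%:R <= D) ->
  (forall i, i \in J -> strip N i.+1 (pt i)) ->
  (forall i, i \in J -> H <= cabs (expsum N a (pt i).1 (pt i).2)) -> 0 <= H ->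
  (#|J|%:R * H) ^+ 4 <=
    (\sum_(1 <= n < N.+1) cabs (a n) ^+ 2) ^+ 2 * #|J|%:R ^+ 2 *
    (653 * D * N%:R ^+ 2 * #|J|%:R).
Proof.
move=> N0 hD hstrip hH H0.
pose x i := e1 (pt i).1; pose y i := e1 (pt i).2.
pose u i n := x i ^+ n * y i ^+ (n ^ 2).
have fE i : expsum N a (pt i).1 (pt i).2 = \sum_(1 <= n < N.+1) a n * u i n.
  by apply: eq_bigr => n _; rewrite e1D -natrX !e1_natM.
have far j k : j \in J -> k \in J -> far_strips j k ->
    2 <= N%:R * `|1 - y j * (y k)^*|.
  have pred (m : 'I_N) : m.+1%:R - 1 = m%:R :> R by rewrite -natr1 addrK.
  move=> /hstrip[_ hj] /hstrip[_ hk]; move: hj hk; rewrite !pred.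
  exact: far_strips_chord.
have hDC v : (0 < v < N * (4 * N))%N -> (size (divisors v))%:R <= D%:C.
  by move=> /hD; rewrite -lecR rmorph_nat.
have JN : (#|J| <= N)%N by rewrite -[leqRHS]card_ord max_card.
have := @parabola_energy_le _ _ J N (@far_strips N) x y D%:C N0
  (fun=> norm_e1 _) (fun=> norm_e1 _) JN (fun j _ => card_near_strips J j) far hDC.
move=> energy; rewrite -lecR.
have := duality J (index_iota 1 N.+1) a u.
set A := \sum_(1 <= n < N.+1) `|a n| ^+ 2 => dual.
have -> : ((\sum_(1 <= n < N.+1) cabs (a n) ^+ 2) ^+ 2 * #|J|%:R ^+ 2 *
    (653 * D * N%:R ^+ 2 * #|J|%:R))%:C =
    A ^+ 2 * #|J|%:R ^+ 2 * (653 * D%:C * N%:R ^+ 2 * #|J|%:R).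
  rewrite !(rmorphM, rmorphXn, rmorph_nat, rmorph_sum)/=.
  by congr (_ ^+ 2 * _ * _); apply: eq_bigr => n _; rewrite norm_cabs rmorphXn.
apply: le_trans (le_trans _ dual) _; last first.
  by rewrite ler_wpM2l// mulr_ge0// exprn_ge0// sumr_ge0// => n _; rewrite exprn_ge0.
rewrite rmorphXn lerXn2r ?nnegrE ?sumr_ge0//.
  by rewrite ler0c mulr_ge0.
rewrite rmorphM rmorph_nat mulr_natl -sumr_const.
by apply: ler_sum => i iJ; rewrite -fE norm_cabs lecR hH.
Qed.
End characters.

Unset Implicit Arguments.

Theorem corollary1 (R : realType) (K1 K2 : R) (hK1 : 0 < K1) (hK2 : 0 < K2)
    (eps : R) (heps : 0 < eps) :
  exists2 C : R, 0 < C &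
    forall (N : nat) (a : nat -> R[i]) (lambda : R),
      (1 <= N)%N ->
      (exists2 n : nat, (1 <= n <= N)%N & a n != 0) ->
      dyadic lambda ->
      N%:R `^ (1 / 4) <= lambda <= N%:R `^ (1 / 2) ->
      (num_strips K1 K2 N a lambda)%:R
        <= C * N%:R `^ eps * N%:R ^+ 2 * lambda ^- 4.
Proof.
have [C0 C00 hC0] := divisor_bound (divr_gt0 heps (ltr0n R 2)).
have [c c0 cE] : exists2 c : R, 0 < c & c = 653 by exists 653; rewrite ?ltr0n.
exists (c * K2 ^+ 4 * (C0 * 4 `^ (eps / 2))) => [|N a lambda N0 [n0 n0N an0] _].
  by rewrite !mulr_gt0 ?exprn_gt0 ?powR_gt0.
move=> /andP[lamN _].
have N0R : 0 < N%:R :> R by rewrite ltr0n.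
have lam0 : 0 < lambda by apply: lt_le_trans lamN; rewrite powR_gt0.
(* The integers v < 4 N^2 satisfy v^(eps / 2) <= 4^(eps / 2) N^eps. *)
pose D : R := C0 * (4 `^ (eps / 2) * N%:R `^ eps).
have hD v : (0 < v < N * (4 * N))%N -> (size (divisors v))%:R <= D.
  move=> /andP[v0 vN]; apply: le_trans (hC0 v v0) _; rewrite ler_pM2l//.
  have -> : 4 `^ (eps / 2) * N%:R `^ eps = (N * (4 * N))%:R `^ (eps / 2) :> R.
    rewrite !natrM !powRM// mulrCA; congr (_ * _).
    by rewrite -powRD -?splitr// gt_eqF.
  apply: ge0_ler_powR; rewrite ?nnegrE ?ler0n//; first by rewrite divr_ge0// ltW.
  by rewrite ler_nat ltnW.
rewrite /num_strips; set J := [set i | _]%SET.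
have /choice[pt hpt] : forall i : 'I_N, exists p : R * R, i \in J ->
    strip N i.+1 p /\ sim K1 K2 (cabs (expsum N a p.1 p.2)) (lambda * l2norm N a).
  move=> i; have [|iJ] := boolP (i \in J); last by exists (0, 0).
  by rewrite inE => /asboolP[p ps pf]; exists p.
set A := \sum_(1 <= n < N.+1) cabs (a n) ^+ 2.
have A0 : 0 < A.
  rewrite /A (bigD1_seq n0) ?iota_uniq//=; last by rewrite mem_index_iota ltnS.
  rewrite ltr_wpDr ?sumr_ge0//; first by move=> n _; rewrite sqr_ge0.
  by rewrite exprn_gt0// -ltcR -norm_cabs normr_gt0.
have H0 : 0 <= lambda * l2norm N a / K2.
  by rewrite mulr_ge0 ?invr_ge0 ?mulr_ge0 ?sqrtr_ge0// ltW.
have hH i : i \in J ->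
    lambda * l2norm N a / K2 <= cabs (expsum N a (pt i).1 (pt i).2).
  by move=> /hpt[_ [_ low]]; rewrite ler_pdivrMr// [leRHS]mulrC.
have := large_values_bound N0 hD (fun i iJ => (hpt i iJ).1) hH H0.
rewrite -cE /l2norm -/A; set M : R := #|J|%:R.
have [M0|M0] : M = 0 \/ 0 < M.
  by have := ler0n R #|J|; rewrite le_eqVlt => /predU1P[/esym|]; [left|right].
- by move=> _; rewrite M0 !mulr_ge0 ?exprn_ge0 ?powR_ge0 ?invr_ge0 ?exprn_ge0// ltW.
have -> : (M * (lambda * Num.sqrt A / K2)) ^+ 4 =
    (A ^+ 2 * M ^+ 3) * (M * lambda ^+ 4 / K2 ^+ 4).
  rewrite -{2}(sqr_sqrtr (ltW A0)); field; by rewrite gt_eqF.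
have -> : A ^+ 2 * M ^+ 2 * (c * D * N%:R ^+ 2 * M) =
    (A ^+ 2 * M ^+ 3) * (c * D * N%:R ^+ 2) by ring.
rewrite ler_pM2l ?mulr_gt0 ?exprn_gt0// ler_pdivrMr ?exprn_gt0//.
rewrite -ler_pdivlMr ?exprn_gt0// => /le_trans; apply.
by rewrite /D le_eqVlt; apply/orP; left; apply/eqP; ring.
Qed.
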